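(* Let $n$ be a positive integer, let $Q\in\mathbb{C}^{n\times n}$ be an idempotent and let $P\in\mathbb{C}^{n\times n}$ be a projection. If $\|P-Q\|_F=\|m(Q)-Q\|_F$, where $m(Q)$ is the matched projection of $Q$, then $P=m(Q)$.
   Context: An idempotent is a matrix $Q$ with $Q^2=Q$; a projection is a Hermitian idempotent ($P=P^*=P^2$). $\|\cdot\|_F$ is the Frobenius norm, $A^*$ the conjugate transpose, $A^\dag$ the Moore-Penrose inverse, and $|A|=(A^*A)^{1/2}$ the positive semi-definite square root, so $|Q^*|=(QQ^* )^{1/2}$. For an idempotent $Q\in\mathbb{C}^{n\times n}$ the matched projection is $$m(Q)=\tfrac12\big(|Q^*|+Q^*\big)\,|Q^*|^\dag\,\big(|Q^*|+I_n\big)^{-1}\big(|Q^*|+Q\big),$$ which is known to be a projection. *)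

(* Defs.v *)
From mathcomp Require Import all_boot all_order all_algebra.
From mathcomp Require Import complex.
From mathcomp Require Import boolp classical_sets reals.

Set Implicit Arguments.
Unset Strict Implicit.
Unset Printing Implicit Defensive.

Import Order.TTheory GRing.Theory Num.Theory.

Local Open Scope ring_scope.
Local Open Scope sesquilinear_scope.
Local Open Scope classical_set_scope.

Section Definitions.
Variable C : numClosedFieldType.

Definition idempotent_mx n (Q : 'M[C]_n) : Prop := Q *m Q = Q.

Definition projection_mx n (P : 'M[C]_n) : Prop := P^t* = P /\ P *m P = P.

Definition frobenius_norm m n (A : 'M[C]_(m, n)) : C :=
  sqrtC (\sum_i \sum_j `|A i j| ^+ 2).

(* In a numClosedFieldType, [0 <= z] entails that z is real. *)
Definition psdmx n (A : 'M[C]_n) : Prop :=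
  A^t* = A /\ forall v : 'cV[C]_n, 0 <= (v^t* *m A *m v) 0 0.

Definition is_mxabs m n (A : 'M[C]_(m, n)) (S : 'M[C]_n) : Prop :=
  psdmx S /\ S *m S = A^t* *m A.

(* |A| = (A^* A)^(1/2); see mxabsP and mxabs_unique. *)
Definition mxabs m n (A : 'M[C]_(m, n)) : 'M[C]_n :=
  xget 0 [set S | is_mxabs A S].

(* The four Penrose equations. *)
Definition is_mxpinv m n (A : 'M[C]_(m, n)) (X : 'M[C]_(n, m)) : Prop :=
  [/\ A *m X *m A = A, X *m A *m X = X,
      (A *m X)^t* = A *m X & (X *m A)^t* = X *m A].

(* The Moore-Penrose inverse; see mxpinvP and mxpinv_unique. It differs in
   general from pinvmx, which need not satisfy the two Hermitian conditions. *)
Definition mxpinv m n (A : 'M[C]_(m, n)) : 'M[C]_(n, m) :=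
  xget 0 [set X | is_mxpinv A X].

(* The inverse below is a genuine one: see unitmx_mxabsD1. *)
Definition matched_projection n (Q : 'M[C]_n) : 'M[C]_n :=
  let S := mxabs (Q^t*) in
  2^-1 *: ((S + Q^t*) *m mxpinv S *m invmx (S + 1%:M) *m (S + Q)).

End Definitions.

Section Facts.
Variable C : numClosedFieldType.

Lemma adjmxM m n p (A : 'M[C]_(m, n)) (B : 'M[C]_(n, p)) :
  (A *m B)^t* = B^t* *m A^t*.
Proof. by rewrite trmx_mul map_mxM. Qed.

Lemma adjmxD m n (A B : 'M[C]_(m, n)) : (A + B)^t* = A^t* + B^t*.
Proof. by apply/matrixP => i j; rewrite !mxE rmorphD. Qed.

Lemma adjmxN m n (A : 'M[C]_(m, n)) : (- A)^t* = - A^t*.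
Proof. by apply/matrixP => i j; rewrite !mxE rmorphN. Qed.

Lemma adjmx_mulE m n (A : 'M[C]_(m, n)) j :
  (A^t* *m A) j j = \sum_i `|A i j| ^+ 2.
Proof. by rewrite mxE; apply: eq_bigr => i _; rewrite !mxE mulrC -normCK. Qed.

Lemma adjmx_mul_ge0 m n (A : 'M[C]_(m, n)) j : 0 <= (A^t* *m A) j j.
Proof. by rewrite adjmx_mulE sumr_ge0 // => i _; rewrite exprn_ge0. Qed.

Lemma adjmx_mul_diag0 m n (A : 'M[C]_(m, n)) :
  (forall j, (A^t* *m A) j j = 0) -> A = 0.
Proof.
move=> A0; apply/matrixP => i j; rewrite mxE; apply/eqP.
have /eqP := A0 j; rewrite adjmx_mulE psumr_eq0 => [|k _]; last first.
  by rewrite exprn_ge0.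
by move=> /allP/(_ i (mem_index_enum i)) /=; rewrite expf_eq0 /= normr_eq0.
Qed.

Lemma psdmx_adj_mul m n (A : 'M[C]_(m, n)) : psdmx (A^t* *m A).
Proof.
split=> [|v]; first by rewrite adjmxM trmxCK.
by rewrite mulmxA -adjmxM -mulmxA adjmx_mul_ge0.
Qed.

Lemma psdmx_conj_ge0 m n (X : 'M[C]_n) (A : 'M[C]_(m, n)) j :
  psdmx X -> 0 <= (A *m X *m A^t*) j j.
Proof.
case=> _ /(_ (col j (A^t*))); congr (0 <= _).
rewrite !mxE; apply: eq_bigr => i _; rewrite !mxE; congr (_ * _).
by apply: eq_bigr => k _; rewrite !mxE conjCK.
Qed.

Lemma psdmx_unitD1 n (S : 'M[C]_n) : psdmx S -> S + 1%:M \in unitmx.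
Proof.
move=> S0; rewrite -row_free_unit -kermx_eq0; apply/eqP.
set K := kermx _; have KS : K *m (S + 1%:M) = 0 by exact: mulmx_ker.
suff K0 : K^t* = 0 by rewrite -[K]trmxCK K0 trmx0 map_mx0.
apply: adjmx_mul_diag0 => j; rewrite trmxCK; apply/eqP.
have := adjmx_mul_ge0 (K^t*) j; rewrite trmxCK => K0.
rewrite eq_le K0 andbT.
have := psdmx_conj_ge0 K j S0.
move/eqP: KS; rewrite mulmxDr mulmx1 addr_eq0 => /eqP ->.
by rewrite mulNmx mxE oppr_ge0.
Qed.

Lemma is_mxabs_exists m n (A : 'M[C]_(m, n)) : exists S, is_mxabs A S.
Proof.
have B0 := psdmx_adj_mul A; have [Bh _] := B0; set B := A^t* *m A in Bh B0 *.
have Bn : B \is normalmx by apply/normalmxP; rewrite Bh.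
have U := spectral_unitarymx B.
have := orthomx_spectralP Bn; rewrite invmx_unitary //.
set P := spectralmx B in U *; set d := spectral_diag B => BE.
have PP : P *m P^t* = 1%:M by apply/unitarymxP.
have dE j : d 0 j = (P *m B *m P^t*) j j.
  rewrite BE !mulmxA PP mul1mx -mulmxA PP mulmx1.
  by rewrite mxE eqxx mulr1n.
have d0 j : 0 <= d 0 j by rewrite dE psdmx_conj_ge0.
pose r : 'rV[C]_n := \row_j sqrtC (sqrtC (d 0 j)).
pose T := diag_mx r *m P.
have Th : (diag_mx r)^t* = diag_mx r.
  apply/matrixP => i j; rewrite !mxE eq_sym; case: eqVneq => [->|_].
    by rewrite !mulr1n geC0_conj // !sqrtC_ge0.
  by rewrite !mulr0n rmorph0.
exists (T^t* *m T); split; first exact: psdmx_adj_mul.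
rewrite -/B BE /T adjmxM Th !mulmxA; congr (_ *m _).
rewrite -!mulmxA; congr (_ *m _).
rewrite (mulmxA P) PP mul1mx !mulmx_diag; congr diag_mx.
apply/rowP => j; rewrite !mxE; set s := sqrtC (sqrtC _).
have -> : d 0 j = s ^+ (2 * 2) by rewrite exprM !sqrtCK.
by rewrite !exprS expr0 mulr1 !mulrA.
Qed.

Lemma mxabsP m n (A : 'M[C]_(m, n)) : is_mxabs A (mxabs A).
Proof. exact: (xgetPex 0 (is_mxabs_exists A)). Qed.

Lemma psdmx_sqr_inj n (S T : 'M[C]_n) :
  psdmx S -> psdmx T -> S *m S = T *m T -> S = T.
Proof.
move=> S0 T0 ST; have [Sh _] := S0; have [Th _] := T0.
apply/eqP; rewrite -subr_eq0; apply/eqP.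
set D := S - T; have Dh : D^t* = D by rewrite adjmxD adjmxN Sh Th.
have Dn : D \is normalmx by apply/normalmxP; rewrite Dh.
have U := spectral_unitarymx D.
have := orthomx_spectralP Dn; rewrite invmx_unitary //.
set P := spectralmx D in U *; set d := spectral_diag D => DE.
have PP : P *m P^t* = 1%:M by apply/unitarymxP.
have PD : P *m D = diag_mx d *m P by rewrite DE !mulmxA PP mul1mx.
have DP : D *m P^t* = P^t* *m diag_mx d by rewrite DE -!mulmxA PP mulmx1.
suff d0 : d = 0 by rewrite DE d0 raddf0 mulmx0 mul0mx.
apply/rowP => j; rewrite [RHS]mxE.
have ED : S *m D + D *m T = 0.
  by rewrite mulmxBr mulmxBl ST addrA subrK subrr.
have dj : d 0 j = (P *m S *m P^t*) j j - (P *m T *m P^t*) j j.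
  have <- : (P *m D *m P^t*) j j = d 0 j.
    by rewrite PD -mulmxA PP mulmx1 mxE eqxx mulr1n.
  by rewrite mulmxBr mulmxBl mxE [X in _ + X]mxE.
have : (P *m (S *m D + D *m T) *m P^t*) j j = 0.
  by rewrite ED mulmx0 mul0mx mxE.
rewrite mulmxDr mulmxDl mxE.
rewrite -mulmxA -(mulmxA S) DP !mulmxA PD mul_mx_diag -!mulmxA mul_diag_mx.
rewrite mxE [X in _ + X]mxE mulrC -mulrDr !mulmxA => /eqP.
rewrite mulf_eq0 => /orP[/eqP //|].
by rewrite paddr_eq0 ?psdmx_conj_ge0 // dj => /andP[/eqP -> /eqP ->]; rewrite subrr.
Qed.

Lemma mxabs_unique m n (A : 'M[C]_(m, n)) (S : 'M[C]_n) :
  is_mxabs A S -> mxabs A = S.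
Proof.
move=> [S0 SE]; have [T0 TE] := mxabsP A.
by apply: psdmx_sqr_inj => //; rewrite TE SE.
Qed.

Lemma unitmx_mxabsD1 m n (A : 'M[C]_(m, n)) : mxabs A + 1%:M \in unitmx.
Proof. by have [/psdmx_unitD1] := mxabsP A. Qed.

Lemma row_free_adj_unit m n (A : 'M[C]_(m, n)) :
  row_free A -> A *m A^t* \in unitmx.
Proof.
move=> Af; rewrite -row_free_unit -kermx_eq0; set K := kermx _.
have KA : K *m (A *m A^t*) = 0 by exact: mulmx_ker.
suff K0 : (K *m A)^t* = 0.
  have : K *m A = 0 by rewrite -[_ *m _]trmxCK K0 trmx0 map_mx0.
  by move/eqP; rewrite mulmx_free_eq0.
apply: adjmx_mul_diag0 => j.
by rewrite trmxCK adjmxM !mulmxA -(mulmxA K) KA mul0mx mxE.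
Qed.

Lemma adjmx_inv n (A : 'M[C]_n) : (invmx A)^t* = invmx (A^t*).
Proof. by rewrite trmx_inv map_invmx. Qed.

Lemma is_mxpinv_exists m n (A : 'M[C]_(m, n)) : exists X, is_mxpinv A X.
Proof.
have [r [B [D [AE Bf Df]]]] : exists r (B : 'M[C]_(m, r)) (D : 'M[C]_(r, n)),
    [/\ A = B *m D, row_full B & row_free D].
  exists (\rank A), (col_base A), (row_base A).
  by rewrite mulmx_base col_base_full row_base_free.
have DU := row_free_adj_unit Df.
have BU : B^t* *m B \in unitmx.
  rewrite -{2}[B]trmxCK; apply: row_free_adj_unit.
  by rewrite /row_free mxrank_map mxrank_tr.
pose X := D^t* *m invmx (D *m D^t*) *m (invmx (B^t* *m B) *m B^t*).
have AX : A *m X = B *m invmx (B^t* *m B) *m B^t*.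
  by rewrite AE /X !mulmxA -(mulmxA B) -(mulmxA B) mulmxV // mulmx1.
have XA : X *m A = D^t* *m invmx (D *m D^t*) *m D.
  by rewrite AE /X -!mulmxA (mulmxA _ B) (mulmxA _ _ D) mulVmx // mul1mx.
exists X; split.
- by rewrite AX {1}AE -!mulmxA (mulmxA _ B) (mulmxA _ _ D) mulVmx ?mul1mx.
- by rewrite XA /X -!mulmxA (mulmxA D) (mulmxA (D *m _)) mulmxV ?mul1mx.
- by rewrite AX !adjmxM trmxCK adjmx_inv adjmxM trmxCK mulmxA.
- by rewrite XA !adjmxM trmxCK adjmx_inv adjmxM trmxCK mulmxA.
Qed.

Lemma mxpinvP m n (A : 'M[C]_(m, n)) : is_mxpinv A (mxpinv A).
Proof. exact: (xgetPex 0 (is_mxpinv_exists A)). Qed.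

Lemma mxpinv_unique m n (A : 'M[C]_(m, n)) (X : 'M[C]_(n, m)) :
  is_mxpinv A X -> mxpinv A = X.
Proof.
move=> [x1 x2 x3 x4]; have [] := mxpinvP A; set Y := mxpinv A => y1 y2 y3 y4.
have AE : A *m Y = A *m X.
  by rewrite -[LHS]y3 -{1}x1 -(mulmxA (A *m X)) adjmxM x3 y3 mulmxA y1.
have XE : X *m A = Y *m A.
  rewrite -[LHS]x4 -{1}y1 -(mulmxA A) (mulmxA X) adjmxM x4 y4.
  by rewrite -mulmxA (mulmxA A) x1.
by rewrite -y2 -XE -mulmxA AE mulmxA.
Qed.

End Facts.

(* Main.v *)
(* Write [Q'] for the adjoint of [Q]. For a projection [P],
   ||P - Q||^2 = tr (Q' Q) - tr (P H) with H = Q + Q' - I, so the hypothesis says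
   tr (P H) = tr (M H), where M = m(Q). Since H^2 = I + (Q - Q')(Q - Q')',
   H is invertible. With S = |Q'| one has (S + Q) H = S (S + Q); hence M H is
   Hermitian, i.e. M commutes with H, and A = (2M - I) H is positive
   semidefinite, i.e. M is the spectral projection of H on its positive part.
   With D = M - P, tr (M H) - tr (P H) = tr (D A D), so D A = 0, then
   D H = D A (2M - I) = 0 and D = 0. *)
Require Import Defs.
From mathcomp Require Import all_boot all_order all_algebra.
From mathcomp Require Import complex.
From mathcomp Require Import reals.
From mathcomp Require Import ring.

Import Order.TTheory GRing.Theory Num.Theory.

Local Open Scope ring_scope.

(** * Positive semidefinite matrices, traces and Frobenius distances *)

Section PositiveSemidefinite.
Set Implicit Arguments.
Unset Strict Implicit.
Local Open Scope sesquilinear_scope.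
Variable C : numClosedFieldType.

Lemma psdmxD n (A B : 'M[C]_n) : psdmx A -> psdmx B -> psdmx (A + B).
Proof.
move=> [Ah A0] [Bh B0]; split; first by rewrite adjmxD Ah Bh.
by move=> v; rewrite mulmxDr mulmxDl mxE addr_ge0.
Qed.

Lemma psdmx_conj m n (A : 'M[C]_(m, n)) (X : 'M[C]_n) :
  psdmx X -> psdmx (A *m X *m A^t*).
Proof.
move=> [Xh X0]; split; first by rewrite !adjmxM trmxCK Xh mulmxA.
move=> v; have := X0 (A^t* *m v).
by rewrite adjmxM trmxCK !mulmxA.
Qed.

Lemma psdmx_projection n (E : 'M[C]_n) : projection_mx E -> psdmx E.
Proof. by case=> Eh EE; have := psdmx_adj_mul E; rewrite Eh EE. Qed.

Lemma adjmx1 n : (1%:M : 'M[C]_n)^t* = 1%:M.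
Proof. by rewrite trmx1 map_mx1. Qed.

Lemma adjmxB m n (A B : 'M[C]_(m, n)) : (A - B)^t* = A^t* - B^t*.
Proof. by rewrite adjmxD adjmxN. Qed.

Lemma adjmxZ m n (a : C) (A : 'M[C]_(m, n)) :
  a \is Num.real -> (a *: A)^t* = a *: A^t*.
Proof.
by move=> ar; apply/matrixP => i j; rewrite !mxE rmorphM /= conj_Creal.
Qed.

Lemma comm_invmx n (S B : 'M[C]_n) :
  S \in unitmx -> B *m S = S *m B -> B *m invmx S = invmx S *m B.
Proof.
move=> Su BS; rewrite -[LHS]mul1mx -(mulVmx Su) -mulmxA (mulmxA S) -BS.
by rewrite -mulmxA mulmxV // mulmx1.
Qed.

Lemma projection_mxC n (E : 'M[C]_n) :
  projection_mx E -> projection_mx (1%:M - E).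
Proof.
case=> Eh EE; split; first by rewrite adjmxB adjmx1 Eh.
by rewrite mulmxBl mul1mx mulmxBr mulmx1 EE subrr subr0.
Qed.

(** The diagonal entries of [D *m A *m D^t*] are nonnegative, so a zero trace kills each of them.
    Splitting a squared norm off each entry replaces the use of a square root of [A]. *)
Lemma psdmx_trace_conj_eq0 m n (A : 'M[C]_n) (D : 'M[C]_(m, n)) :
  psdmx A -> \tr (D *m A *m D^t*) = 0 -> D *m A = 0.
Proof.
move=> A0 tr0; have [Ah _] := A0; have u := psdmx_unitD1 A0.
set R := invmx (A + 1%:M).
have AR : A *m R = R *m A.
  by apply: comm_invmx => //; rewrite mulmxDr mulmxDl mulmx1 mul1mx.
have Rh : R^t* = R by rewrite adjmx_inv adjmxD adjmx1 Ah.
pose Z := D *m R.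
have DE : D = Z *m (A + 1%:M) by rewrite -mulmxA mulVmx // mulmx1.
(* [A = R (A + 1) A (A + 1) R] dominates [R A^2 R = (A R)^* (A R)]. *)
have E : D *m A *m D^t* = Z *m A *m A *m (Z *m A)^t* +
    (Z *m A *m (Z *m A)^t* + Z *m A *m (Z *m A)^t*) + Z *m A *m Z^t*.
  rewrite {}DE !adjmxM adjmxD adjmx1 Ah !(mulmxDl, mulmxDr) !mulmx1 !mul1mx.
  by rewrite !mulmxA !addrA.
have ZA0 : (Z *m A)^t* = 0.
  apply: adjmx_mul_diag0 => j; rewrite trmxCK.
  have p1 i : 0 <= (Z *m A *m A *m (Z *m A)^t*) i i by apply: psdmx_conj_ge0.
  have p2 i : 0 <= (Z *m A *m (Z *m A)^t*) i i.
    by have := adjmx_mul_ge0 ((Z *m A)^t*) i; rewrite trmxCK.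
  have p3 i : 0 <= (Z *m A *m Z^t*) i i by apply: psdmx_conj_ge0.
  have p i : 0 <= (D *m A *m D^t*) i i by apply: psdmx_conj_ge0.
  have /eqP : (D *m A *m D^t*) j j = 0.
    move/eqP: tr0; rewrite /mxtrace psumr_eq0 // => /allP.
    by move=> /(_ j (mem_index_enum j)) /= /eqP.
  rewrite {}E mxE [X in X + _]mxE [X in _ + X + _]mxE.
  rewrite paddr_eq0 ?addr_ge0 // => /andP[+ _].
  by rewrite paddr_eq0 ?addr_ge0 // => /andP[_]; rewrite paddr_eq0 // => /andP[/eqP].
have ZA : Z *m A = 0 by rewrite -[Z *m A]trmxCK ZA0 trmx0 map_mx0.
by rewrite DE mulmxDr mulmxDl mulmx1 ZA mul0mx add0r.
Qed.

Lemma sqr_frobenius_norm m n (A : 'M[C]_(m, n)) :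
  frobenius_norm A ^+ 2 = \tr (A^t* *m A).
Proof.
rewrite sqrtCK exchange_big; apply: eq_bigr => j _.
by rewrite adjmx_mulE.
Qed.

(** The quadratic term collapses to [P] itself, so the squared distance is affine in [P]. *)
Lemma sqr_frobenius_norm_projectionB n (P Q : 'M[C]_n) : projection_mx P ->
  frobenius_norm (P - Q) ^+ 2 =
  \tr (Q^t* *m Q) - \tr (P *m (Q + Q^t* - 1%:M)).
Proof.
case=> Ph PP; rewrite sqr_frobenius_norm adjmxB Ph.
rewrite !(mulmxBr, mulmxBl, mulmxDr) mulmx1 PP !(raddfB, raddfD) /=.
rewrite (mxtrace_mulC (Q^t*) P); ring.
Qed.

Lemma projection_trace_unique n (H M P : 'M[C]_n) :
  projection_mx M -> projection_mx P -> H *m H \in unitmx ->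
  M *m H = H *m M -> psdmx (2 *: (M *m H) - H) ->
  \tr (P *m H) = \tr (M *m H) -> P = M.
Proof.
move=> [Mh MM] [Ph PP] Hu MH; set A := _ - H => A0 trPM.
have AE : A = 2 *: (M *m H) - H by []; clearbody A.
set D := M - P; have Dh : D^t* = D by rewrite adjmxB Mh Ph.
have AM : A *m M = H *m M.
  by rewrite AE mulmxBl -scalemxAl MH -mulmxA MM scaler_nat mulr2n addrK.
have MA : M *m A = M *m H.
  by rewrite AE mulmxBr -scalemxAr mulmxA MM scaler_nat mulr2n addrK.
have trD : \tr (D *m A *m D^t*) = 0.
  rewrite Dh mxtrace_mulC mulmxA.
  have -> : D *m D = M - P *m M + (P - M *m P).
    by rewrite mulmxBr !mulmxBl MM PP opprB.
  rewrite mulmxDl !mulmxBl !raddfD /= !raddfN /= MA.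
  rewrite -(mulmxA P M) MA -(mulmxA M P) (mxtrace_mulC M (P *m A)).
  rewrite -(mulmxA P A) AM -MH.
  (* The two mixed terms tr (P M H) found so far cancel against this one. *)
  have -> : \tr (P *m A) = 2 * \tr (P *m (M *m H)) - \tr (P *m H).
    by rewrite AE mulmxBr -scalemxAr raddfB /= linearZ.
  rewrite trPM; ring.
have DA := psdmx_trace_conj_eq0 A0 trD.
(* [2M - I] is an involution, so multiplying [A] by it recovers [H]. *)
have HE : H = A *m (2 *: M - 1%:M).
  by rewrite mulmxBr mulmx1 -scalemxAr AM AE MH opprB addrC subrK.
have DH : D *m H = 0 by rewrite HE mulmxA DA mul0mx.
have : D = 0.
  by rewrite -[D]mulmx1 -(mulmxV Hu) !mulmxA DH !mul0mx.
by move/eqP; rewrite subr_eq0 eq_sym => /eqP.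
Qed.

(** The adjoint of the inverse also solves the Penrose equations of [S], so uniqueness applies;
    commutation is then the Hermitian condition. *)
Lemma mxpinv_herm n (S : 'M[C]_n) : S^t* = S ->
  (mxpinv S)^t* = mxpinv S /\ mxpinv S *m S = S *m mxpinv S.
Proof.
move=> Sh; have [] := mxpinvP S; set X := mxpinv S => x1 x2 x3 x4.
have XS : (X *m S)^t* = S *m X^t* by rewrite adjmxM Sh.
have SX : (S *m X)^t* = X^t* *m S by rewrite adjmxM Sh.
have Xh : X^t* = X.
  apply: esym; apply: mxpinv_unique; split.
  - by rewrite -[RHS]Sh -{3}x1 !adjmxM Sh mulmxA.
  - by rewrite -{3}x2 !adjmxM Sh mulmxA.
  - by rewrite -XS x4.
  - by rewrite -SX x3.
by split=> //; rewrite -x4 XS Xh.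
Qed.

End PositiveSemidefinite.

(** * Algebra of the matched projection *)

Section MatchedProjection.
Set Implicit Arguments.
Unset Strict Implicit.
Local Open Scope sesquilinear_scope.
Variables (C : numClosedFieldType) (n : nat) (Q : 'M[C]_n).
Hypothesis QQ : idempotent_mx Q.

Let S := mxabs (Q^t*).
Let X := mxpinv S.
(* The orthogonal projection onto the range of [Q]. *)
Let E := S *m X.
Let R := invmx (S + 1%:M).
Let H := Q + Q^t* - 1%:M.

Let S0 : psdmx S. Proof. by case: (mxabsP (Q^t*)). Qed.
Let Sh : S^t* = S. Proof. by case: S0. Qed.
Let SS : S *m S = Q *m Q^t*.
Proof. by case: (mxabsP (Q^t*)) => _; rewrite trmxCK. Qed.
Let Xh : X^t* = X. Proof. by case: (mxpinv_herm Sh). Qed.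
Let XS : X *m S = E. Proof. by case: (mxpinv_herm Sh). Qed.
Let ES : E *m S = S. Proof. by case: (mxpinvP S). Qed.
Let XE : X *m E = X. Proof. by case: (mxpinvP S) => _; rewrite -mulmxA. Qed.
Let SE : S *m E = S. Proof. by rewrite -XS mulmxA ES. Qed.
Let Eproj : projection_mx E.
Proof. by split; [case: (mxpinvP S) | rewrite /E mulmxA ES]. Qed.
Let Eh : E^t* = E. Proof. by case: Eproj. Qed.
Let EE : E *m E = E. Proof. by case: Eproj. Qed.

(** [S = S S X = Q Q' X] has its range inside that of [Q], where [Q] acts as the identity. *)
Let QS : Q *m S = S.
Proof. by rewrite -SE /E !mulmxA -(mulmxA Q) SS mulmxA QQ. Qed.
Let SQ : S *m Q^t* = S.
Proof. by rewrite -{1}Sh -adjmxM QS. Qed.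
Let QE : Q *m E = E. Proof. by rewrite mulmxA QS. Qed.
Let EQs : E *m Q^t* = E. Proof. by rewrite -{1}Eh -adjmxM QE. Qed.
(** With [B = (I - E) Q], one gets [B B' = (I - E) S S (I - E) = 0]. *)
Let EQ : E *m Q = Q.
Proof.
have : ((1%:M - E) *m Q)^t* = 0.
  apply: adjmx_mul_diag0 => j; rewrite trmxCK adjmxM mulmxA -(mulmxA _ Q) -SS.
  by rewrite mulmxA mulmxBl mul1mx ES subrr !mul0mx mxE.
move/(congr1 (fun A => A^t*)); rewrite trmxCK trmx0 map_mx0 mulmxBl mul1mx.
by move/eqP; rewrite subr_eq0 => /eqP.
Qed.
Let QsE : Q^t* *m E = Q^t*. Proof. by rewrite -{1}Eh -adjmxM EQ. Qed.

Let SU : S + 1%:M \in unitmx. Proof. exact: psdmx_unitD1. Qed.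
Let Rh : R^t* = R. Proof. by rewrite adjmx_inv adjmxD adjmx1 Sh. Qed.
Let comR B : B *m S = S *m B -> B *m R = R *m B.
Proof.
by move=> BS; apply: comm_invmx => //; rewrite mulmxDr mulmxDl BS mulmx1 mul1mx.
Qed.
Let SR : S *m R = R *m S. Proof. exact: comR. Qed.
Let ER : E *m R = R *m E. Proof. by apply: comR; rewrite ES SE. Qed.
Let XR : X *m R = R *m X. Proof. by apply: comR; rewrite XS. Qed.

Let W := E *m R.
(** From [S + E = (S + I) E], conjugated by [R]. *)
Let W0 : psdmx W.
Proof.
have -> : W = R *m S *m R^t* + R *m E *m R^t*.
  rewrite Rh -mulmxDl -mulmxDr -{1}SE -{2}[E]mul1mx -mulmxDl.
  by rewrite mulmxA mulVmx // mul1mx.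
apply: psdmxD; first exact: psdmx_conj.
exact/psdmx_conj/psdmx_projection.
Qed.

Let M := matched_projection Q.
Let ME : M = 2^-1 *: ((S + Q^t*) *m (X *m R) *m (S + Q)).
Proof. by rewrite /M /matched_projection !mulmxA. Qed.

Let adjSQ : (S + Q)^t* = S + Q^t*. Proof. by rewrite adjmxD Sh. Qed.

(** [M] is half of [(S + Q)' K (S + Q)] with [K = X R]. Idempotence follows from
    [(S + Q) (S + Q)' = 2 S (S + I)], of which [K] inverts the factor [S (S + I)] on the range of
    [Q]. *)
Lemma projection_mx_matched_projection : projection_mx M.
Proof.
split.
  by rewrite ME adjmxZ ?realV ?realn // !adjmxM Xh Rh -XR -adjSQ trmxCK mulmxA.
rewrite ME -scalemxAl -scalemxAr; congr (_ *: _).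
set K := X *m R.
have SQ2 : (S + Q) *m (S + Q^t*) = 2 *: (S *m (S + 1%:M)).
  by rewrite mulmxDl !mulmxDr SQ QS -SS mulmx1 (addrC S) scaler_nat mulr2n.
have KK : K *m (S *m (S + 1%:M)) *m K = K.
  rewrite /K {2}XR !mulmxA -(mulmxA _ (S + 1%:M)) mulmxV // mulmx1.
  by rewrite -(mulmxA _ S) -/E -mulmxA -ER mulmxA XE.
clearbody K.
rewrite !mulmxA -(mulmxA _ (S + Q)) SQ2 -scalemxAr -!scalemxAl scalerA.
rewrite mulVf ?pnatr_eq0 // scale1r.
by rewrite -(mulmxA _ K (S *m _)) -(mulmxA _ _ K) KK.
Qed.

Let SQH : (S + Q) *m H = S *m (S + Q).
Proof.
rewrite mulmxBr mulmx1 mulmxDl !mulmxDr SQ QQ SS.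
move: (S *m Q) (Q *m Q^t*) => B D.
by apply/matrixP => i j; rewrite !mxE; ring.
Qed.

(** Moving [H] leftwards past [S + Q] turns it into [S], which cancels [X] up to [E]. *)
Lemma matched_projection_mulH :
  M *m H = 2^-1 *: ((S + Q^t*) *m W *m (S + Q)).
Proof.
have XRS : X *m R *m S = W by rewrite -mulmxA -SR mulmxA XS.
by rewrite ME -scalemxAl -(mulmxA _ (S + Q)) SQH (mulmxA _ S) -(mulmxA _ _ S) XRS.
Qed.

Let Hh : H^t* = H.
Proof. by rewrite adjmxB adjmx1 adjmxD trmxCK (addrC _ Q). Qed.

Lemma matched_projection_comm : M *m H = H *m M.
Proof.
have [Mh _] := projection_mx_matched_projection; have [Wh _] := W0.
rewrite -{2}Hh -{2}Mh -adjmxM matched_projection_mulH adjmxZ ?realV ?realn //.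
rewrite (adjmxM _ (S + Q)) (adjmxM _ W).
by rewrite Wh -adjSQ trmxCK mulmxA.
Qed.

Lemma sqr_addadjB1_unit : H *m H \in unitmx.
Proof.
pose N := Q - Q^t*.
have -> : H *m H = N *m N^t* + 1%:M.
  have QsQs : Q^t* *m Q^t* = Q^t* by rewrite -adjmxM QQ.
  rewrite /N adjmxB trmxCK !(mulmxBl, mulmxBr, mulmxDl, mulmxDr) !mulmx1 !mul1mx.
  rewrite QQ QsQs; move: (Q *m Q^t*) (Q^t* *m Q) => B D.
  by apply/matrixP => i j; rewrite !mxE; ring.
apply: psdmx_unitD1.
by have := psdmx_adj_mul (N^t*); rewrite trmxCK.
Qed.

(** The matrix is block diagonal with respect to [E]: it is [S] on the range of [Q], and the
    identity plus a congruence of [W] on the orthogonal complement. *)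
Lemma psdmx_matched_projection : psdmx (2 *: (M *m H) - H).
Proof.
(* Expand [E = E (S + I) R]; this makes every product of [S] and [W] linear in [E] and [W]. *)
have SRE : S *m R = E - W.
  apply/eqP; rewrite eq_sym subr_eq -[E]mulmx1 -(mulmxV SU) -/R mulmxA.
  by rewrite mulmxDr ES mulmx1 mulmxDl.
have SW : S *m W = E - W by rewrite mulmxA SE.
have WS : W *m S = E - W by rewrite -mulmxA -SR mulmxA ES.
have EW : E *m W = W by rewrite mulmxA EE.
have WE : W *m E = W by rewrite -mulmxA -ER mulmxA EE.
have MHE := matched_projection_mulH.
clearbody W.
(* The decomposition of [A] along the range of [Q] and its complement. *)
have -> : 2 *: (M *m H) - H = S + (1%:M - E) +
    ((1%:M - E) *m Q^t*) *m W *m ((1%:M - E) *m Q^t*)^t*.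
  rewrite MHE scalerA mulfV ?pnatr_eq0 // scale1r.
  rewrite adjmxM trmxCK adjmxB adjmx1 Eh.
  rewrite mulmxBl mul1mx EQs mulmxBr mulmx1 QE.
  rewrite !(mulmxBl, mulmxBr, mulmxDl, mulmxDr) !(mulNmx, mulmxN).
  rewrite SW EW -!(mulmxA (Q^t*)) WS WE.
  rewrite !(mulmxBl, mulmxBr, mulmxDl, mulmxDr) !(mulNmx, mulmxN) ES EQ WS QsE.
  rewrite /H; move: (W *m Q) => B; move: (Q^t* *m B) (Q^t* *m W) => D G.
  by apply/matrixP => i j; rewrite !mxE; ring.
apply: psdmxD; last exact: psdmx_conj.
by apply: psdmxD => //; apply/psdmx_projection/projection_mxC.
Qed.

End MatchedProjection.

Theorem theorem3p3 (R : realType) (n : nat) (n_gt0 : (0 < n)%N)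
    (Q P : 'M[R[i]]_n) (hQ : idempotent_mx Q) (hP : projection_mx P)
    (hPQ : frobenius_norm (P - Q) = frobenius_norm (matched_projection Q - Q)) :
  P = matched_projection Q.
Proof.
have hM := projection_mx_matched_projection hQ.
apply: (projection_trace_unique hM hP (sqr_addadjB1_unit hQ)).
- exact: matched_projection_comm.
- exact: psdmx_matched_projection.
(* After squaring, both sides share the term tr (Q' Q), which cancels. *)
have := congr1 (fun x => x ^+ 2) hPQ.
by rewrite !sqr_frobenius_norm_projectionB // => /addrI /oppr_inj.
Qed.
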